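(* Let $d\ge2$ be an integer. For $q>0$ set $$c(q)=\limsup_{n\to\infty}\left(\int_0^1\prod_{j=0}^{n-1}|\cos(\pi d^jt)|^q\,dt\right)^{1/n},\qquad \tilde c(q)=\limsup_{n\to\infty}\left(\int_0^1\prod_{j=0}^{n-1}|\sin(\pi d^jt)|^q\,dt\right)^{1/n}.$$ Then the functions $c(q)$ and $\tilde c(q)$ are convex and nonincreasing in $q>0$. Moreover, $$\lim_{q\to\infty}c(q)=\frac1d,\qquad \lim_{q\to\infty}\tilde c(q)=\begin{cases}\frac1d&\text{if $d$ is odd},\\0&\text{if $d$ is even},\end{cases}$$ and $$\lim_{q\to0^+}c(q)=\lim_{q\to0^+}\tilde c(q)=1.$$ *)

(* Defs.v *)
From HB Require Import structures.
From mathcomp Require Import all_boot all_order all_algebra.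
From mathcomp Require Import all_classical all_reals all_analysis.

Set Implicit Arguments.
Unset Strict Implicit.
Unset Printing Implicit Defensive.

Import Order.TTheory GRing.Theory Num.Theory.
Import numFieldNormedType.Exports.

Local Open Scope classical_set_scope.
Local Open Scope ring_scope.

(* The integrals below lie in [0, 1], so the real-valued [limn_sup] is the
   true limit superior, and the root of order [n = 0] is irrelevant to it. *)
Definition cos_rate (R : realType) (d : nat) (q : R) : R :=
  limn_sup (fun n : nat =>
    (\int[lebesgue_measure]_(t in `[0, 1])
       \prod_(0 <= j < n) `|cos (pi * d%:R ^+ j * t)| `^ q) `^ (n%:R^-1)).

Definition sin_rate (R : realType) (d : nat) (q : R) : R :=
  limn_sup (fun n : nat =>
    (\int[lebesgue_measure]_(t in `[0, 1])
       \prod_(0 <= j < n) `|sin (pi * d%:R ^+ j * t)| `^ q) `^ (n%:R^-1)).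

(* Main.v *)
(** Write [w] for [|cos (pi t)|] or [|sin (pi t)|] and [W_n] for the product of
    the [w (d^j t)], [j < n].  Splitting [[0, 1]] into [d] equal pieces gives
    [int h W_(n+1)^q = int (T h) W_n^q] with the transfer operator
    [T h (x) = 1/d * sum_(k < d) (w^q h) ((x + k) / d)].  Hence a pointwise bound
    [T 1 <= lam] bounds the rate by [lam], and [lam h <= T h] for some
    [0 <= h <= 1] of positive integral shows that it is at least [lam].
    - As [q] tends to infinity, at most one of the [d] preimages of [x] is near
      a maximum of [w], so [T 1 <= (1 + (d - 1) rho^q) / d] with [rho < 1]; the
      lower bound [1/d] comes from [h = w^q] and
      [cos (y / d)^2 >= cos y].  For even [d], [sin (pi t)] and [sin (pi d t)]
      cannot both be close to 1, and the sine product decays uniformly.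
    - As [q] tends to 0, the sine is handled with [h = w^(q / (d - 1))] and
      Bernoulli's inequality; [|sin 2x| <= 2 |cos x|] transfers the bound to
      the cosine.
    - Convexity is Hoelder's inequality followed by the weighted AM-GM
      inequality. *)
Require Import Defs.
From HB Require Import structures.
From mathcomp Require Import all_boot all_order all_algebra.
From mathcomp Require Import all_classical all_reals all_analysis.
From mathcomp Require Import ring lra.

Set Implicit Arguments.
Unset Strict Implicit.
Unset Printing Implicit Defensive.

Import Order.TTheory GRing.Theory Num.Theory.
Import numFieldNormedType.Exports.

Local Open Scope classical_set_scope.
Local Open Scope ring_scope.

(** * Limits superior of bounded sequences and of [n]-th roots *)

Lemma unit_bounded_fun (R : realType) (u : nat -> R^o) :
  (forall n, 0 <= u n <= 1) -> bounded_fun u.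
Proof.
move=> u01; exists 1; split; first exact: num_real.
move=> M M1 n _ /=; have /andP[u0 u1] := u01 n.
by rewrite ger0_norm// (le_trans u1)// ltW.
Qed.

Lemma cvg_sups_bounded (R : realType) (u : nat -> R^o) :
  bounded_fun u -> cvgn (sups u).
Proof.
move=> bu; apply: nonincreasing_is_cvgn; last exact: bounded_fun_has_lbound_sups.
exact/nonincreasing_sups/bounded_fun_has_ubound.
Qed.

(** The inequality holds between the tail suprema [sups] at every index. For bounded sequences these
    converge to the limit superior, so it passes to the limit. *)
Lemma le_limn_sup_combination (R : realType) (u v w : nat -> R^o) (a b : R) :
  bounded_fun u -> bounded_fun v -> bounded_fun w -> 0 <= a -> 0 <= b ->
  (forall n, w n <= a * u n + b * v n) ->
  limn_sup w <= a * limn_sup u + b * limn_sup v.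
Proof.
move=> bu bv bw a0 b0 wuv.
have cu := cvg_sups_bounded bu; have cv := cvg_sups_bounded bv.
have le_sups (x : nat -> R^o) k n : bounded_fun x -> (k <= n)%N -> x n <= sups x k.
  move=> bx kn; apply: ub_le_sup; last by exists n.
  exact/has_ubound_sdrop/bounded_fun_has_ubound.
have -> : a * limn_sup u + b * limn_sup v =
    limn (fun n => a * sups u n + b * sups v n).
  apply/esym/cvg_lim => //.
  by apply: cvgD; apply: cvgMl_tmp.
apply: ler_lim; first exact: cvg_sups_bounded.
  by apply: is_cvgD; apply: is_cvgMl_tmp.
apply: nearW => k; apply: ge_sup; first by exists (w k); exists k => /=.
move=> _ [n /= kn <-]; apply: (le_trans (wuv n)).
by apply: lerD; apply: ler_wpM2l => //; exact: le_sups.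
Qed.

Lemma le_limn_sup (R : realType) (u v : nat -> R^o) :
  bounded_fun u -> bounded_fun v -> (forall n, u n <= v n) ->
  limn_sup u <= limn_sup v.
Proof.
move=> bu bv uv.
have := @le_limn_sup_combination R v v u 1 0 bv bv bu ler01 (lexx _).
by rewrite !mul1r !mul0r !addr0; apply => n; rewrite mul1r mul0r addr0.
Qed.

(** For [n > 0] the root is [expR (ln C / n) * lam], and [ln C / n] tends to 0. The value at
    [n = 0], where the exponent [0^-1] is 0, is discarded by [near]. *)
Lemma cvg_geometric_root (R : realType) (C lam : R) : 0 < C -> 0 < lam ->
  (C * lam ^+ n) `^ (n%:R^-1) @[n --> \oo] --> lam.
Proof.
move=> C0 lam0.
have hinv : (n%:R : R)^-1 @[n --> \oo] --> (0 : R).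
  apply/gtr0_cvgV0; last exact: cvgr_idn.
  by near=> n; rewrite ltr0n; near: n; exact: nbhs_infty_gt.
have hexp : expR (n%:R^-1 * ln C) @[n --> \oo] --> expR (0 * ln C).
  by apply: continuous_cvg; [exact: continuous_expR|exact: cvgMr_tmp].
have h : expR (n%:R^-1 * ln C) * lam @[n --> \oo] --> expR (0 * ln C) * lam.
  exact: cvgMr_tmp.
rewrite mul0r expR0 mul1r in h.
apply: cvg_trans h; apply: near_eq_cvg; near=> n.
have n0 : n%:R != 0 :> R by rewrite pnatr_eq0 -lt0n; near: n; exact: nbhs_infty_gt.
rewrite powRM ?exprn_ge0 ?ltW// -powR_mulrn ?ltW// -powRrM mulfV// powRr1 ?ltW//.
by rewrite /powR gt_eqF.
Unshelve. all: end_near. Qed.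

Lemma powR_unit (R : realType) (x r : R) :
  0 <= x <= 1 -> 0 <= r -> 0 <= x `^ r <= 1.
Proof.
move=> /andP[x0 x1] r0; rewrite powR_ge0/=.
by rewrite (le_trans (ge0_ler_powR r0 _ _ x1)) ?nnegrE ?ler01// powR1.
Qed.

Lemma limn_sup_root_ge (R : realType) (u : nat -> R) (C lam : R) :
  (forall n, 0 <= u n <= 1) -> 0 < C -> 0 < lam ->
  (forall n, C * lam ^+ n <= u n) ->
  lam <= limn_sup (fun n => u n `^ (n%:R^-1) : R^o).
Proof.
move=> u01 C0 lam0 ule; have hc := cvg_geometric_root C0 lam0.
have [_ <-] := cvg_limn_inf_sup hc.
apply: le_limn_sup.
- by apply/cvg_seq_bounded/cvg_ex; exists lam.
- by apply: unit_bounded_fun => n; apply: powR_unit.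
- move=> n; rewrite ge0_ler_powR// ?nnegrE ?invr_ge0//.
    by rewrite mulr_ge0 ?exprn_ge0// ltW.
  by have /andP[] := u01 n.
Qed.

Lemma limn_sup_root_le (R : realType) (u : nat -> R) (C lam : R) :
  (forall n, 0 <= u n <= 1) -> 0 < C -> 0 < lam ->
  (forall n, u n <= C * lam ^+ n) ->
  limn_sup (fun n => u n `^ (n%:R^-1) : R^o) <= lam.
Proof.
move=> u01 C0 lam0 ule; have hc := cvg_geometric_root C0 lam0.
have [_ <-] := cvg_limn_inf_sup hc.
apply: le_limn_sup.
- by apply: unit_bounded_fun => n; apply: powR_unit.
- by apply/cvg_seq_bounded/cvg_ex; exists lam.
- move=> n; rewrite ge0_ler_powR// ?nnegrE ?invr_ge0//.
    by have /andP[] := u01 n.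
  by rewrite mulr_ge0 ?exprn_ge0// ltW.
Qed.

(** * Real powers, and integrals over segments *)

(** Young's inequality for [x ^ t] and [y ^ (1 - t)] with the conjugate exponents [1 / t] and
    [1 / (1 - t)]; the endpoints [t = 0] and [t = 1] are treated apart. *)
Lemma powR_weighted_AMGM (R : realType) (x y t : R) :
  0 <= x -> 0 <= y -> 0 <= t <= 1 ->
  x `^ t * y `^ (1 - t) <= t * x + (1 - t) * y.
Proof.
move=> x0 y0 /andP[t0 t1].
have [->|tn0] := eqVneq t 0; first by rewrite powRr0 subr0 powRr1// !mul1r mul0r add0r.
have [->|tn1] := eqVneq t 1; first by rewrite powRr1// subrr powRr0 mulr1 mul1r mul0r addr0.
have {tn0}t0 : 0 < t by rewrite lt_neqAle eq_sym tn0.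
have {tn1}s0 : 0 < 1 - t by rewrite subr_gt0 lt_neqAle tn1.
have := @conjugate_powR R (x `^ t) (y `^ (1 - t)) t^-1 (1 - t)^-1.
rewrite -!powRrM !mulfV ?gt_eqF// !invrK !powRr1// (mulrC x) (mulrC y).
by apply; rewrite ?powR_ge0 ?invr_gt0//; ring.
Qed.

(** Where [f x > 0] the power is differentiable. At a zero of [f], [f y < e ^ (1 / q)] gives
    [f y ^ q < e] directly. *)
Lemma continuous_powR_ge0 (R : realType) (f : R -> R) (q : R) :
  0 < q -> (forall x, 0 <= f x) -> continuous f ->
  continuous (fun x => f x `^ q).
Proof.
move=> q0 f0 cf x.
have [fx0|] := eqVneq (f x) 0; last first.
  move=> fxn0; have {fxn0}fx0 : 0 < f x by rewrite lt0r fxn0 f0.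
  apply: (@continuous_comp _ _ _ f (fun y : R => y `^ q)); first exact: cf.
  apply: (@differentiable_continuous _ _ _ (f x) (fun y => y `^ q)).
  apply/derivable1_diffP.
  by apply: derivable_powR; rewrite in_itv/= andbT.
rewrite /continuous_at fx0 powR0 ?gt_eqF//; apply/cvgrPdist_lt => e e0.
have e'0 : 0 < e `^ q^-1 by rewrite powR_gt0.
have := cf x; rewrite /continuous_at fx0 => /cvgrPdist_lt /(_ _ e'0).
apply: filterS => y; rewrite !sub0r !normrN !ger0_norm ?powR_ge0// => fye.
have -> : e = (e `^ q^-1) `^ q by rewrite -powRrM mulVf ?gt_eqF// powRr1// ltW.
by apply: gt0_ltr_powR; rewrite ?nnegrE ?f0// ltW.
Qed.

Lemma continuous_mul_cst (R : realType) (c : R) (f : R -> R) :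
  continuous f -> continuous (fun x => c * f x).
Proof.
move=> cf x; apply: (@continuous_comp _ _ _ f ( *%R c)); first exact: cf.
exact: mulrl_continuous.
Qed.

Lemma continuous_integrable_itv (R : realType) (f : R -> R) (a b : R) :
  continuous f -> (@lebesgue_measure R).-integrable `[a, b] (EFin \o f).
Proof.
move=> cf; apply: continuous_compact_integrable; first exact: segment_compact.
exact: continuous_subspaceT.
Qed.

Lemma Rintegral_itv_affine (R : realType) (f : R -> R) (a c : R) :
  0 < c -> continuous f ->
  \int[lebesgue_measure]_(x in `[a, a + c]) f x =
  c * \int[lebesgue_measure]_(x in `[0, 1]) f (a + c * x).
Proof.
move=> c0 cf.
have cF : continuous (fun x : R => a + c * x).
  by move=> x; apply: cvgD; [exact: cvg_cst|apply: cvgMl_tmp].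
have dF (x : R) : is_derive x 1 (fun x : R => a + c * x) c.
  by apply: is_derive_eq; rewrite add0r mul1r /GRing.scale/= mulr1.
have F'E : derive1 (fun x : R => a + c * x) = cst c.
  by apply/funext => x; rewrite derive1E; exact: derive_val.
rewrite -RintegralZl//; last first.
  apply: continuous_integrable_itv => x.
  by apply: continuous_comp; [exact: cF|exact: cf].
rewrite /Rintegral; congr fine.
have := @integration_by_substitution_increasing R (fun x => a + c * x) f 0 1 ler01.
rewrite mulr0 addr0 mulr1 => ->.
- by apply: eq_integral => x _ /=; rewrite F'E fctE/= mulrC.
- by move=> x y _ _ xy; rewrite ltrD2l ltr_pM2l.
- by rewrite F'E => x _; exact: cvg_cst.
- by rewrite F'E; exact: is_cvg_cst.
- by rewrite F'E; exact: is_cvg_cst.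
- split.
  + by move=> x _; exact: ex_derive.
  + exact/cvg_at_right_filter/cF.
  + exact/cvg_at_left_filter/cF.
- exact: continuous_subspaceT.
Qed.

Lemma Rintegral_itv_cat (R : realType) (f : R -> R) (a b c : R) :
  a <= b -> b <= c -> continuous f ->
  \int[lebesgue_measure]_(x in `[a, c]) f x =
  \int[lebesgue_measure]_(x in `[a, b]) f x +
  \int[lebesgue_measure]_(x in `[b, c]) f x.
Proof.
move=> ab bc cf; apply/eqP; rewrite addrC -subr_eq; apply/eqP.
rewrite Rintegral_itvB ?bnd_simp//; last exact: continuous_integrable_itv.
apply: Rintegral_itv_obnd_cbnd.
apply: integrableS (@continuous_integrable_itv R f b c cf) => //.
exact: subset_itv_oc_cc.
Qed.

Lemma Rintegral_01_split (R : realType) (f : R -> R) (d : nat) :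
  (0 < d)%N -> continuous f ->
  \int[lebesgue_measure]_(x in `[0, 1]) f x =
  d%:R^-1 * \sum_(k < d)
    \int[lebesgue_measure]_(x in `[0, 1]) f ((x + k%:R) / d%:R).
Proof.
move=> d0 cf; have dR0 : 0 < d%:R :> R by rewrite ltr0n.
have dV0 : 0 < d%:R^-1 :> R by rewrite invr_gt0.
(* The pieces are added one at a time, so the claim is generalised to [[0, m / d]]; [m = d] is the
   wanted case. *)
suff H m : \int[lebesgue_measure]_(x in `[0, m%:R / d%:R]) f x =
    d%:R^-1 * \sum_(k < m)
    \int[lebesgue_measure]_(x in `[0, 1]) f ((x + k%:R) / d%:R).
  by rewrite -H mulfV// gt_eqF.
elim: m => [|m IH]; first by rewrite mul0r set_itv1 Rintegral_set1 big_ord0 mulr0.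
rewrite (@Rintegral_itv_cat _ _ 0 (m%:R / d%:R))//; last first.
  by rewrite ler_pM2r// ler_nat.
rewrite IH big_ord_recr/= mulrDr; congr (_ + _).
rewrite -natr1 mulrDl mul1r Rintegral_itv_affine//; congr (_ * _).
by apply: eq_Rintegral => x _; congr f; rewrite mulrDl addrC mulrC.
Qed.

(** * Weights, moments and the transfer operator *)

(** Abstracts what [|cos (pi t)|] and [|sin (pi t)|] share, so that both rates are studied at
    once. *)
Definition weight (R : realType) (w : R -> R) :=
  [/\ continuous w, forall t, 0 <= w t <= 1 & forall t, w (t + 1) = w t].

Definition cascade (R : realType) (w : R -> R) (d n : nat) (t : R) :=
  \prod_(0 <= j < n) w (d%:R ^+ j * t).

(** The power is taken of the whole product, not factor by factor as in [cos_rate] and [sin_rate];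
    [cascade_powR] reconciles the two forms. *)
Definition moment (R : realType) (w : R -> R) (d : nat) (q : R) (n : nat) : R :=
  \int[lebesgue_measure]_(t in `[0, 1]) cascade w d n t `^ q.

Definition rate (R : realType) (w : R -> R) (d : nat) (q : R) : R :=
  limn_sup (fun n => moment w d q n `^ (n%:R^-1)).

(** The Ruelle transfer operator of [t |-> d t] mod 1 with weight [w ^ q], normalised by [1 / d]. *)
Definition transfer (R : realType) (w : R -> R) (d : nat) (q : R) (h : R -> R)
    (x : R) : R :=
  d%:R^-1 * \sum_(k < d) w ((x + k%:R) / d%:R) `^ q * h ((x + k%:R) / d%:R).

Lemma Rintegral01_cst (R : realType) (c : R) :
  \int[lebesgue_measure]_(t in `[0, 1]) (fun=> c) t = c.
Proof.
by rewrite Rintegral_cst//= lebesgue_measure_itv/= lte_fin ltr01/= oppr0 addr0 mulr1.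
Qed.

Lemma le_Rintegral01 (R : realType) (f g : R -> R) :
  continuous f -> continuous g -> (forall t, 0 <= t <= 1 -> f t <= g t) ->
  \int[lebesgue_measure]_(t in `[0, 1]) f t <=
  \int[lebesgue_measure]_(t in `[0, 1]) g t.
Proof.
by move=> cf cg fg; apply: le_Rintegral => //; exact: continuous_integrable_itv.
Qed.

Lemma continuous_sum (R : realType) m (F : 'I_m -> R -> R) :
  (forall k, continuous (F k)) -> continuous (fun x => \sum_(k < m) F k x).
Proof.
elim: m F => [|m IH] F cF x.
  by under eq_fun do rewrite big_ord0; exact: cvg_cst.
under eq_fun do rewrite big_ord_recr/=.
by apply: cvgD; [apply: IH => k|]; exact: cF.
Qed.

Lemma Rintegral01_sum (R : realType) m (F : 'I_m -> R -> R) :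
  (forall k, continuous (F k)) ->
  \int[lebesgue_measure]_(t in `[0, 1]) (\sum_(k < m) F k t) =
  \sum_(k < m) \int[lebesgue_measure]_(t in `[0, 1]) F k t.
Proof.
elim: m F => [|m IH] F cF.
  under eq_Rintegral do rewrite big_ord0.
  by rewrite big_ord0 Rintegral01_cst.
under eq_Rintegral do rewrite big_ord_recr/=.
rewrite RintegralD//; try exact/continuous_integrable_itv/cF.
  by rewrite IH ?big_ord_recr// => k; exact: cF.
by apply/continuous_integrable_itv/continuous_sum => k; exact: cF.
Qed.

Lemma cascade_unit (R : realType) (w : R -> R) d n t :
  weight w -> 0 <= cascade w d n t <= 1.
Proof.
move=> [_ w01 _]; rewrite /cascade; elim/big_ind : _ => //.
- by rewrite ler01 lexx.
- move=> x y /andP[x0 x1] /andP[y0 y1]; rewrite mulr_ge0//=.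
  by rewrite mulr_ile1.
Qed.

Lemma cascade_ge0 (R : realType) (w : R -> R) d n t :
  weight w -> 0 <= cascade w d n t.
Proof. by move=> /(cascade_unit d n t) /andP[]. Qed.

Lemma continuous_cascade (R : realType) (w : R -> R) d n :
  weight w -> continuous (cascade w d n).
Proof.
move=> [cw _ _]; rewrite /cascade; elim: n => [|n IH].
  by move=> x; under eq_fun do rewrite big_geq//; exact: cvg_cst.
have -> : (fun t : R => \prod_(0 <= j < n.+1) w (d%:R ^+ j * t)) =
    (fun t => \prod_(0 <= j < n) w (d%:R ^+ j * t)) \* (fun t : R => w (d%:R ^+ n * t)).
  by apply/funext => t; rewrite big_nat_recr.
have cn : continuous (fun t : R => w (d%:R ^+ n * t)).
  move=> x; apply: (@continuous_comp _ _ _ (fun t : R => d%:R ^+ n * t) w).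
    exact: mulrl_continuous.
  exact: cw.
by move=> x; apply: cvgM; [exact: IH|exact: cn].
Qed.

Lemma continuous_cascade_powR (R : realType) (w : R -> R) d n q :
  weight w -> 0 < q -> continuous (fun t : R => cascade w d n t `^ q).
Proof.
move=> ww q0; apply: continuous_powR_ge0 => //; last exact: continuous_cascade.
by move=> t; exact: cascade_ge0.
Qed.

Lemma cascadeS (R : realType) (w : R -> R) d n t :
  cascade w d n.+1 t = w t * cascade w d n (d%:R * t).
Proof.
rewrite /cascade big_nat_recl// expr0 mul1r; congr (_ * _).
by apply: eq_bigr => j _; rewrite exprSr mulrA.
Qed.

Lemma weightDn (R : realType) (w : R -> R) (m : nat) t :
  weight w -> w (t + m%:R) = w t.
Proof.
move=> [_ _ w1]; elim: m => [|m IH]; first by rewrite addr0.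
by rewrite -natr1 addrA w1 IH.
Qed.

Lemma cascadeDn (R : realType) (w : R -> R) d n (m : nat) t :
  weight w -> cascade w d n (t + m%:R) = cascade w d n t.
Proof.
move=> ww; apply: eq_bigr => j _.
by rewrite mulrDr -natrX -natrM weightDn.
Qed.

Lemma moment_unit (R : realType) (w : R -> R) d q n :
  weight w -> 0 < q -> 0 <= moment w d q n <= 1.
Proof.
move=> ww q0; apply/andP; split.
  by apply: Rintegral_ge0 => t _; exact: powR_ge0.
rewrite -[leRHS]Rintegral01_cst.
apply: le_Rintegral01; first exact: continuous_cascade_powR.
  by move=> x; exact: cvg_cst.
move=> t _; have := @powR_unit R (cascade w d n t) q (cascade_unit _ _ _ ww) (ltW q0).
by case/andP.
Qed.

Lemma continuous_weight_powR (R : realType) (w : R -> R) q :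
  weight w -> 0 < q -> continuous (fun t : R => w t `^ q).
Proof.
move=> [cw w01 _] q0; apply: continuous_powR_ge0 => //.
by move=> t; case/andP : (w01 t).
Qed.

Lemma continuous_transfer (R : realType) (w h : R -> R) d q :
  weight w -> 0 < q -> continuous h -> continuous (transfer w d q h).
Proof.
move=> ww q0 ch.
have cL k : continuous (fun x : R => (x + k) / d%:R).
  move=> x; apply: (@continuous_comp _ _ _ (fun x : R => x + k) ( *%R^~ d%:R^-1)).
    by apply: cvgD; [exact: cvg_id|exact: cvg_cst].
  exact: mulrr_continuous.
apply: continuous_mul_cst; apply: continuous_sum => k x; apply: cvgM.
  apply: (@continuous_comp _ _ _ (fun x : R => (x + k%:R) / d%:R)
    (fun t => w t `^ q)); [exact: cL|exact: continuous_weight_powR].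
by apply: continuous_comp; [exact: cL|exact: ch].
Qed.

(** On the [k]-th piece, [t = (x + k) / d] and [d t = x + k]; by periodicity the last [n] factors of
    the cascade at [t] form the cascade at [x], whatever [k] is. *)
Lemma Rintegral_transfer (R : realType) (w h : R -> R) d q n :
  (0 < d)%N -> weight w -> 0 < q -> continuous h ->
  \int[lebesgue_measure]_(t in `[0, 1]) (h t * cascade w d n.+1 t `^ q) =
  \int[lebesgue_measure]_(t in `[0, 1])
    (transfer w d q h t * cascade w d n t `^ q).
Proof.
move=> d0 ww q0 ch; have dn0 : d%:R != 0 :> R by rewrite pnatr_eq0 -lt0n.
have w0 t : 0 <= w t by case: ww => _ /(_ t) /andP[].
have cL k : continuous (fun x : R => (x + k) / d%:R).
  move=> x; apply: (@continuous_comp _ _ _ (fun x : R => x + k) ( *%R^~ d%:R^-1)).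
    by apply: cvgD; [exact: cvg_id|exact: cvg_cst].
  exact: mulrr_continuous.
rewrite (Rintegral_01_split d0); last first.
  by move=> x; apply: cvgM; [exact: ch|exact: continuous_cascade_powR].
have cE (k : 'I_d) : continuous (fun x : R => w ((x + k%:R) / d%:R) `^ q *
    h ((x + k%:R) / d%:R) * cascade w d n x `^ q).
  move=> x; apply: cvgM; last exact: continuous_cascade_powR.
  apply: cvgM; last by apply: continuous_comp; [exact: cL|exact: ch].
  apply: (@continuous_comp _ _ _ (fun x : R => (x + k%:R) / d%:R)
    (fun t => w t `^ q)); [exact: cL|exact: continuous_weight_powR].
transitivity (d%:R^-1 * \sum_(k < d) \int[lebesgue_measure]_(x in `[0, 1])
   (w ((x + k%:R) / d%:R) `^ q * h ((x + k%:R) / d%:R) * cascade w d n x `^ q)).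
  congr (_ * _); apply: eq_bigr => k _; apply: eq_Rintegral => x _.
  rewrite cascadeS mulrCA mulfV// mulr1 cascadeDn// powRM ?cascade_ge0//.
  by rewrite mulrA [h _ * _]mulrC.
under [RHS]eq_Rintegral do rewrite /transfer -mulrA mulr_suml.
rewrite RintegralZl//; last exact/continuous_integrable_itv/continuous_sum.
by rewrite Rintegral01_sum.
Qed.

(** Each use of [Rintegral_transfer] removes one factor of the cascade and gains a factor [lam];
    finally [h <= 1] compares the integral with the moment. *)
Lemma moment_ge_transfer (R : realType) (w h : R -> R) d q lam :
  (0 < d)%N -> weight w -> 0 < q -> continuous h ->
  (forall t, 0 <= h t <= 1) -> 0 <= lam ->
  (forall t, 0 <= t <= 1 -> lam * h t <= transfer w d q h t) ->
  forall n, (\int[lebesgue_measure]_(t in `[0, 1]) h t) * lam ^+ n <=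
    moment w d q n.
Proof.
move=> d0 ww q0 ch h01 lam0 hlam n.
have cch m : continuous (fun t : R => h t * cascade w d m t `^ q).
  by move=> x; apply: cvgM; [exact: ch|exact: continuous_cascade_powR].
apply: (@le_trans _ _
    (\int[lebesgue_measure]_(t in `[0, 1]) (h t * cascade w d n t `^ q))).
  elim: n => [|n IH].
    rewrite mulr1; apply: le_Rintegral01 => //.
    by move=> t _; rewrite /cascade big_geq// powR1 mulr1.
  rewrite exprSr mulrA Rintegral_transfer//.
  apply: (le_trans (ler_wpM2r lam0 IH)); rewrite mulrC -RintegralZl//; last first.
    exact: continuous_integrable_itv.
  apply: le_Rintegral01.
  - by apply: continuous_mul_cst; exact: cch.
  - move=> x; apply: cvgM; last exact: continuous_cascade_powR.
    exact: continuous_transfer.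
  - by move=> t /hlam ht; rewrite mulrA ler_wpM2r// powR_ge0.
apply: le_Rintegral01 => //; first exact: continuous_cascade_powR.
by move=> t _; rewrite ler_piMl ?powR_ge0//; case/andP : (h01 t).
Qed.

Lemma moment_le_transfer (R : realType) (w : R -> R) d q lam :
  (0 < d)%N -> weight w -> 0 < q -> 0 <= lam ->
  (forall t, 0 <= t <= 1 -> transfer w d q (fun=> 1) t <= lam) ->
  forall n, moment w d q n <= lam ^+ n.
Proof.
move=> d0 ww q0 lam0 hlam; elim=> [|n IH].
  by have /andP[] := moment_unit d 0 ww q0.
have c1 : continuous (fun _ : R => 1 : R) by move=> x; exact: cvg_cst.
have -> : moment w d q n.+1 =
    \int[lebesgue_measure]_(t in `[0, 1]) (1 * cascade w d n.+1 t `^ q).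
  by apply: eq_Rintegral => t _; rewrite mul1r.
rewrite (@Rintegral_transfer _ w (fun=> 1))// exprS.
apply: (le_trans _ (ler_wpM2l lam0 IH)); rewrite -RintegralZl//; last first.
  exact/continuous_integrable_itv/continuous_cascade_powR.
apply: le_Rintegral01.
- move=> x; apply: cvgM; last exact: continuous_cascade_powR.
  exact: continuous_transfer.
- by apply: continuous_mul_cst; exact: continuous_cascade_powR.
- by move=> t /hlam ht; rewrite ler_wpM2r// powR_ge0.
Qed.

(** * Monotonicity and convexity of the rate *)

Lemma nonincreasing_rate (R : realType) (w : R -> R) d p q :
  weight w -> 0 < p -> p <= q -> rate w d q <= rate w d p.
Proof.
move=> ww p0 pq; have q0 := lt_le_trans p0 pq.
apply: le_limn_sup.
- by apply: unit_bounded_fun => n; apply: powR_unit => //; exact: moment_unit.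
- by apply: unit_bounded_fun => n; apply: powR_unit => //; exact: moment_unit.
move=> n; have /andP[mp _] := moment_unit d n ww p0.
have /andP[mq _] := moment_unit d n ww q0.
apply: ge0_ler_powR; rewrite ?nnegrE ?invr_ge0//.
apply: le_Rintegral01; try exact: continuous_cascade_powR.
move=> t _; have /andP[c0 c1] := cascade_unit d n t ww.
(* [ger_powR] is applied to a positive base; at a zero of the cascade both powers vanish because the
   exponents are positive. *)
have [->|cn0] := eqVneq (cascade w d n t) 0.
  by rewrite !powR0 ?gt_eqF.
by apply: ger_powR => //; rewrite lt0r cn0 c0.
Qed.

(** Weighted AM-GM for [c ^ p / a] and [c ^ q / b]. With the two moments as [a] and [b], this is the
    pointwise form of Hoelder's inequality. *)
Lemma powR_interpolation (R : realType) (a b c p q t : R) :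
  0 < a -> 0 < b -> 0 <= c -> 0 <= t <= 1 -> 0 < t * p + (1 - t) * q ->
  c `^ (t * p + (1 - t) * q) <=
  a `^ t * b `^ (1 - t) * (t / a * c `^ p + (1 - t) / b * c `^ q).
Proof.
move=> a0 b0 c0 t01 r0.
have ab0 : 0 <= a `^ t * b `^ (1 - t) by rewrite mulr_ge0 ?powR_ge0.
have -> : c `^ (t * p + (1 - t) * q) = (c `^ p) `^ t * (c `^ q) `^ (1 - t).
  rewrite powRD; last by rewrite gt_eqF.
  by rewrite -!powRrM (mulrC p) (mulrC q).
have ca0 : 0 <= c `^ p / a by rewrite divr_ge0 ?powR_ge0// ltW.
have cb0 : 0 <= c `^ q / b by rewrite divr_ge0 ?powR_ge0// ltW.
have := ler_wpM2l ab0 (powR_weighted_AMGM ca0 cb0 t01).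
rewrite mulrACA -!powRM ?(ltW a0) ?(ltW b0)// (mulrC a) (mulrC b) !divfK ?gt_eqF//.
by rewrite (mulrC (c `^ p)) (mulrC (c `^ q)) !mulrA.
Qed.

Lemma moment_hoelder (R : realType) (w : R -> R) d n p q (t : R) :
  weight w -> 0 < p -> 0 < q -> 0 <= t <= 1 ->
  0 < moment w d p n -> 0 < moment w d q n ->
  moment w d (t * p + (1 - t) * q) n <=
  moment w d p n `^ t * moment w d q n `^ (1 - t).
Proof.
move=> ww p0 q0 t01 mp mq; have /andP[t0 t1] := t01.
set a := moment w d p n; set b := moment w d q n.
have r0 : 0 < t * p + (1 - t) * q.
  have [->|tn0] := eqVneq t 0; first by rewrite mul0r add0r subr0 mul1r.
  by apply: ltr_pwDl; [rewrite mulr_gt0// lt0r tn0|rewrite mulr_ge0 ?subr_ge0// ltW].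
have cc r : 0 < r -> continuous (fun x : R => cascade w d n x `^ r).
  exact: continuous_cascade_powR.
have czc r z : 0 < r -> continuous (fun x : R => z * cascade w d n x `^ r).
  by move=> r_gt0; apply: continuous_mul_cst; exact: cc.
apply: (@le_trans _ _ (\int[lebesgue_measure]_(x in `[0, 1])
  (a `^ t * b `^ (1 - t) * (t / a * cascade w d n x `^ p +
                            (1 - t) / b * cascade w d n x `^ q)))).
  apply: le_Rintegral01; first exact: cc.
    by apply: continuous_mul_cst => x; apply: cvgD; exact: czc.
  by move=> x _; apply: powR_interpolation => //; exact: cascade_ge0.
rewrite RintegralZl//; last first.
  by apply/continuous_integrable_itv => x; apply: cvgD; exact: czc.
rewrite RintegralD//; try exact/continuous_integrable_itv/czc.
rewrite !RintegralZl//; try exact/continuous_integrable_itv/cc.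
(* Normalised by [a] and [b], the two integrals are 1, and the weights [t] and [1 - t] add up to
   1. *)
rewrite -/(moment w d p n) -/(moment w d q n) -/a -/b !divfK ?gt_eqF//.
by rewrite subrKC mulr1.
Qed.

(** The [n]-th root of Hoelder's bound is a weighted geometric mean of the two roots, so convexity
    holds for each [n] and passes to the limit superior. Positive moments are what Hoelder's
    inequality divides by. *)
Lemma rate_convex_combination (R : realType) (w : R -> R) d (s p q : R) :
  weight w -> (forall q n, 0 < q -> 0 < moment w d q n) ->
  0 <= s <= 1 -> 0 < p -> 0 < q ->
  rate w d (s * p + (1 - s) * q) <= s * rate w d p + (1 - s) * rate w d q.
Proof.
move=> ww m0 s01 p0 q0; have /andP[s0 s1] := s01.
have r0 : 0 < s * p + (1 - s) * q.
  have [->|sn0] := eqVneq s 0; first by rewrite mul0r add0r subr0 mul1r.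
  by apply: ltr_pwDl; [rewrite mulr_gt0// lt0r sn0|rewrite mulr_ge0 ?subr_ge0// ltW].
apply: le_limn_sup_combination => //; try by rewrite subr_ge0.
- by apply: unit_bounded_fun => n; apply: powR_unit => //; exact: moment_unit.
- by apply: unit_bounded_fun => n; apply: powR_unit => //; exact: moment_unit.
- by apply: unit_bounded_fun => n; apply: powR_unit => //; exact: moment_unit.
move=> n; have mp := m0 p n p0; have mq := m0 q n q0.
have /ltW mr := m0 _ n r0.
have hoelder := moment_hoelder ww p0 q0 s01 mp mq.
apply: le_trans (powR_weighted_AMGM (powR_ge0 _ _) (powR_ge0 _ _) s01).
move: (moment w d p n) (moment w d q n) (moment w d (_ + _) n) mp mq mr hoelder.
move=> a b c a0 b0 c0 cab.
rewrite (powRAC a) (powRAC b) -powRM ?powR_ge0//.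
by apply: ge0_ler_powR; rewrite ?nnegrE ?invr_ge0// mulr_ge0 ?powR_ge0.
Qed.

Lemma convex_rate (R : realType) (w : R -> R) d :
  weight w -> (forall q n, 0 < q -> 0 < moment w d q n) ->
  convex_function (`]0, +oo[%classic : set R^o) (rate w d : R^o -> R^o).
Proof.
move=> ww m0 t p q; rewrite !inE/= !in_itv/= !andbT => p0 q0.
by apply: rate_convex_combination => //; rewrite ge0 le1.
Qed.

(** * The cosine and sine weights *)

Definition cosw (R : realType) (t : R) : R := `|cos (pi * t)|.

Definition sinw (R : realType) (t : R) : R := `|sin (pi * t)|.

Lemma weight_cosw (R : realType) : weight (@cosw R).
Proof.
split.
- move=> t; apply: (@continuous_comp _ _ _ (fun t : R => cos (pi * t)) (fun y : R => `|y|)).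
    apply: (@continuous_comp _ _ _ ( *%R (pi : R)) cos).
      exact: mulrl_continuous.
    exact: continuous_cos.
  exact: norm_continuous.
- by move=> t; rewrite normr_ge0/= cos_max.
- by move=> t; rewrite /cosw mulrDr mulr1 cosDpi normrN.
Qed.

Lemma weight_sinw (R : realType) : weight (@sinw R).
Proof.
split.
- move=> t; apply: (@continuous_comp _ _ _ (fun t : R => sin (pi * t)) (fun y : R => `|y|)).
    apply: (@continuous_comp _ _ _ ( *%R (pi : R)) sin).
      exact: mulrl_continuous.
    exact: continuous_sin.
  exact: norm_continuous.
- by move=> t; rewrite normr_ge0/= sin_max.
- by move=> t; rewrite /sinw mulrDr mulr1 sinDpi normrN.
Qed.

Lemma cascade_powR (R : realType) (w : R -> R) d n t (q : R) : weight w ->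
  cascade w d n t `^ q = \prod_(0 <= j < n) w (d%:R ^+ j * t) `^ q.
Proof.
move=> ww; have [_ w01 _] := ww; elim: n => [|n IH].
  by rewrite /cascade !big_geq// powR1.
rewrite big_nat_recr//= -IH /cascade big_nat_recr//= powRM//.
  exact: (cascade_ge0 d n t ww).
by case/andP : (w01 (d%:R ^+ n * t)).
Qed.

Lemma cos_rateE (R : realType) d : cos_rate d = rate (@cosw R) d.
Proof.
apply/funext => q; congr limn_sup; apply/funext => n; congr (_ `^ _).
apply: eq_Rintegral => t _; rewrite cascade_powR; last exact: weight_cosw.
by apply: eq_bigr => j _; rewrite /cosw mulrA.
Qed.

Lemma sin_rateE (R : realType) d : sin_rate d = rate (@sinw R) d.
Proof.
apply/funext => q; congr limn_sup; apply/funext => n; congr (_ `^ _).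
apply: eq_Rintegral => t _; rewrite cascade_powR; last exact: weight_sinw.
by apply: eq_bigr => j _; rewrite /sinw mulrA.
Qed.

(** * Sine inequalities and separation of preimages *)

Lemma normr_sin_mulnl (R : realType) (n : nat) (x : R) :
  `|sin (n%:R * x)| <= n%:R * `|sin x|.
Proof.
elim: n => [|n IH]; first by rewrite !mul0r sin0 normr0.
rewrite -natr1 mulrDl mul1r sinD (le_trans (ler_normD _ _))// !normrM.
rewrite mulrDl mul1r lerD//.
  by rewrite (le_trans _ IH)// ler_piMr// cos_max.
by rewrite ler_piMl// cos_max.
Qed.

Lemma normr_sinB_sin (R : realType) (x y : R) :
  `|sin (x - y)| <= `|sin x| + `|sin y|.
Proof.
rewrite sinB (le_trans (ler_normB _ _))// !normrM lerD//.
  by rewrite ler_piMr// cos_max.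
by rewrite ler_piMl// cos_max.
Qed.

Lemma normr_sinB_cos (R : realType) (x y : R) :
  `|sin (x - y)| <= `|cos x| + `|cos y|.
Proof.
rewrite sinB (le_trans (ler_normB _ _))// !normrM addrC lerD//.
  by rewrite ler_piMr// sin_max.
by rewrite ler_piMl// sin_max.
Qed.

(** A minimum of finitely many positive values, built up by induction on a bound for [m]. *)
Lemma sin_pi_frac_lb (R : realType) (d : nat) : exists2 e : R, 0 < e &
  forall m : nat, (0 < m < d)%N -> e <= sin (pi * (m%:R / d%:R)).
Proof.
suff H n : exists2 e : R, 0 < e &
    forall m : nat, (0 < m < d)%N -> (m < n)%N -> e <= sin (pi * (m%:R / d%:R)).
  have [e e0 he] := H d; exists e => // m md; apply: he => //.
  by case/andP: md.
elim: n => [|n [e e0 he]]; first by exists 1.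
have [nd|nd] := boolP (0 < n < d)%N; last first.
  exists e => // m md; rewrite ltnS leq_eqVlt => /predU1P[mn|]; last exact: he.
  by move: nd; rewrite -mn md.
exists (Num.min e (sin (pi * (n%:R / d%:R)))).
  rewrite lt_min e0/=; apply: sin_gt0_pi; case/andP: nd => n0 nd.
  have d0 : (0 < d)%N by exact: ltn_trans nd.
  rewrite mulr_gt0 ?pi_gt0 ?divr_gt0 ?ltr0n//=.
  by rewrite gtr_pMr ?pi_gt0// ltr_pdivrMr ?ltr0n// mul1r ltr_nat.
move=> m md; rewrite ltnS leq_eqVlt => /predU1P[->|mn].
  by rewrite ge_min lexx orbT.
by rewrite ge_min he.
Qed.

(* The arguments [pi (x + k) / d] of two preimages differ by [pi m / d] with
   [0 < m < d], whose sine is bounded below. *)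
Lemma separated_preimages (R : realType) (d : nat) : (2 <= d)%N ->
  exists2 e : R, 0 < e <= d%:R^-1 & forall u : R -> R,
    (forall x y, `|sin (x - y)| <= `|u x| + `|u y|) ->
    forall x, exists k0 : 'I_d, forall k : 'I_d, k != k0 ->
      e <= `|u (pi * ((x + k%:R) / d%:R))|.
Proof.
move=> d2; have d0 : (0 < d)%N by exact: ltn_trans d2.
have dR0 : 0 < d%:R :> R by rewrite ltr0n.
have [e0 e0_gt0 he0] := sin_pi_frac_lb R d.
(* Half of [e0], because two values of [|u|] below it sum to less than [e0]; the cap [1 / d] serves
   the estimate [|sin (d z)| <= d |sin z|] in [moment_sinw_ge]. *)
exists (Num.min (e0 / 2) d%:R^-1).
  by rewrite lt_min ge_min lexx orbT andbT divr_gt0//= invr_gt0.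
move=> u hu x; set e := Num.min _ _.
have ee0 : e + e <= e0 by rewrite [leRHS]splitr lerD// ge_min lexx.
pose y (k : 'I_d) := pi * ((x + k%:R) / d%:R).
have sep (i j : 'I_d) : (j < i)%N -> `|u (y i)| < e -> e <= `|u (y j)|.
  move=> ji ui; rewrite leNgt; apply/negP => uj.
  have /he0 : (0 < i - j < d)%N.
    by rewrite subn_gt0 ji/= (leq_ltn_trans (leq_subr _ _)).
  apply/negP; rewrite -ltNge; apply: lt_le_trans ee0.
  have -> : pi * ((i - j)%:R / d%:R) = y i - y j.
    by rewrite /y natrB ?(ltnW ji)//; ring.
  apply: (le_lt_trans (ler_norm _)); apply: (le_lt_trans (hu _ _)).
  exact: ltrD.
have [[k0 hk0]|/forallNP none] := pselect (exists k, `|u (y k)| < e).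
  exists k0 => k kk0; rewrite leNgt; apply/negP => hk.
  have : k != k0 :> nat by [].
  rewrite neq_ltn => /orP[kl|lk].
    by have := sep _ _ kl hk0; rewrite leNgt hk.
  by have := sep _ _ lk hk; rewrite leNgt hk0.
(* If no preimage has a small [|u|], any index may be the exception. *)
exists (Ordinal d0) => k _; rewrite leNgt; apply/negP; exact: none.
Qed.

(** By continuity [f >= f t0 / 2] on some [[t0, t0 + c]]; [t0 < 1] leaves room to the right within
    [[0, 1]]. *)
Lemma Rintegral01_gt0 (R : realType) (f : R -> R) (t0 : R) :
  continuous f -> (forall t, 0 <= f t) -> 0 <= t0 < 1 -> 0 < f t0 ->
  0 < \int[lebesgue_measure]_(t in `[0, 1]) f t.
Proof.
move=> cf f0 /andP[t00 t01] ft0.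
have ft20 : 0 < f t0 / 2 by rewrite divr_gt0.
have /cvgrPdist_lt/(_ _ ft20) := cf t0.
move=> /nbhs_ballP[e /= e0 he].
pose c := Num.min (e / 2) (1 - t0).
have c0 : 0 < c by rewrite lt_min divr_gt0//= subr_gt0.
have ce : c < e.
  by rewrite /c gt_min; apply/orP; left; lra.
have c1 : t0 + c <= 1 by rewrite -lerBrDl ge_min lexx orbT.
have lec : t0 <= t0 + c by rewrite lerDl ltW.
have int_ge0 a b : 0 <= \int[lebesgue_measure]_(t in `[a, b]) f t.
  by apply: Rintegral_ge0.
rewrite (Rintegral_itv_cat t00 (ltW t01))// (Rintegral_itv_cat lec c1)//.
apply: ltr_wpDl => //; apply: ltr_wpDr => //.
rewrite Rintegral_itv_affine// mulr_gt0//.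
apply: (lt_le_trans ft20); rewrite -[leLHS]Rintegral01_cst.
apply: le_Rintegral01.
- by move=> x; exact: cvg_cst.
- move=> x; apply: (@continuous_comp _ _ _ (fun x : R => t0 + c * x) f).
    by apply: cvgD; [exact: cvg_cst|exact: mulrl_continuous].
  exact: cf.
move=> t /andP[t0' t1'].
have := he (t0 + c * t); rewrite /ball/= opprD addNKr normrN.
rewrite ger0_norm ?mulr_ge0 ?(ltW c0)// => H.
have {H}/H : c * t < e by rewrite (le_lt_trans _ ce)// ler_piMr// ltW.
move=> /ltr_distlDr; rewrite [X in X < _ -> _]splitr ltrD2r.
by move/ltW.
Qed.

Lemma Rintegral_sinw_gt0 (R : realType) (s : R) : 0 < s ->
  0 < \int[lebesgue_measure]_(t in `[0, 1]) (sinw t `^ s : R).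
Proof.
move=> s0; apply: (@Rintegral01_gt0 _ _ 2^-1).
- exact: continuous_weight_powR (weight_sinw R) s0.
- by move=> t; exact: powR_ge0.
- by rewrite invr_ge0 ler0n invf_lt1// ltr1n.
- by rewrite powR_gt0// /sinw sin_pihalf normr1.
Qed.

Lemma Rintegral_cosw_gt0 (R : realType) (s : R) : 0 < s ->
  0 < \int[lebesgue_measure]_(t in `[0, 1]) (cosw t `^ s : R).
Proof.
move=> s0; apply: (@Rintegral01_gt0 _ _ 0).
- exact: continuous_weight_powR (weight_cosw R) s0.
- by move=> t; exact: powR_ge0.
- by rewrite lexx ltr01.
- by rewrite powR_gt0// /cosw mulr0 cos0 normr1.
Qed.

(** * Upper bound on the rate, for large [q] *)

Lemma sum_except_one_le (R : realType) d (F : 'I_d -> R) (k0 : 'I_d) (r : R) :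
  F k0 <= 1 -> (forall k, k != k0 -> F k <= r) ->
  \sum_(k < d) F k <= 1 + d.-1%:R * r.
Proof.
move=> F1 Fr; rewrite (bigD1 k0)//= lerD//.
apply: (@le_trans _ _ (\sum_(k < d | k != k0) r)); first exact: ler_sum.
rewrite sumr_const.
by rewrite cardC1 card_ord mulr_natl.
Qed.

Lemma sum_except_one_ge (R : realType) d (F : 'I_d -> R) (k0 : 'I_d) (a r : R) :
  a <= F k0 -> (forall k, k != k0 -> r <= F k) ->
  a + d.-1%:R * r <= \sum_(k < d) F k.
Proof.
move=> aF Fr; rewrite (bigD1 k0)//= lerD//.
apply: (@le_trans _ _ (\sum_(k < d | k != k0) r)); last exact: ler_sum.
rewrite sumr_const.
by rewrite cardC1 card_ord mulr_natl.
Qed.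

(* [u] is the complementary function: where [|u|] is not small, [w] stays away
   from 1. *)
Lemma rate_le_separated (R : realType) (w u : R -> R) d :
  (2 <= d)%N -> weight w ->
  (forall x y, `|sin (x - y)| <= `|u x| + `|u y|) ->
  (forall t, w t ^+ 2 + u (pi * t) ^+ 2 = 1) ->
  exists2 rho : R, 0 < rho < 1 & forall q, 0 < q ->
    rate w d q <= d%:R^-1 * (1 + d.-1%:R * rho `^ q).
Proof.
move=> d2 ww hu wu; have d0 : (0 < d)%N by exact: ltn_trans d2.
have dR0 : 0 < d%:R :> R by rewrite ltr0n.
have [e /andP[e0 ed] he] := separated_preimages R d2.
have e1 : e < 1.
  by rewrite (le_lt_trans ed)// invf_lt1// ltr1n.
have ee0 : 0 < 1 - e ^+ 2 by nra.
(* By [w ^ 2 + u ^ 2 = 1], a preimage with [|u| >= e] has [w <= sqrt (1 - e ^ 2)]; the exceptional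
   one is bounded by 1. *)
exists (Num.sqrt (1 - e ^+ 2)).
  rewrite sqrtr_gt0 ee0/= -[ltRHS]sqrtr1 ltr_sqrt//.
  by rewrite gtrBl exprn_gt0.
move=> q q0; set rho := Num.sqrt _.
have rho0 : 0 <= rho by exact: sqrtr_ge0.
have w01 t : 0 <= w t <= 1 by case: ww.
have lam0 : 0 < d%:R^-1 * (1 + d.-1%:R * rho `^ q).
  by rewrite mulr_gt0 ?invr_gt0// ltr_pwDl// mulr_ge0// powR_ge0.
apply: (@limn_sup_root_le _ _ 1) => //.
- by move=> n; exact: moment_unit.
- move=> n; rewrite mul1r; apply: moment_le_transfer => //; first exact: ltW.
  move=> x _; rewrite /transfer ler_pM2l ?invr_gt0//.
  have [k0 hk0] := he u hu x; apply: (@sum_except_one_le _ _ _ k0).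
    by rewrite mulr1; have /andP[] := powR_unit (w01 ((x + k0%:R) / d%:R)) (ltW q0).
  move=> k kk0; rewrite mulr1; have /andP[wk0 _] := w01 ((x + k%:R) / d%:R).
  apply: ge0_ler_powR; rewrite ?nnegrE ?(ltW q0)//.
  rewrite -(ger0_norm wk0) -sqrtr_sqr ler_sqrt ?(ltW ee0)//.
  have := wu ((x + k%:R) / d%:R); have := hk0 k kk0.
  rewrite -(real_normK (num_real (u _))).
  set b := `|_|; set a := w _; move=> eb; nra.
Qed.

(** * Lower bounds on the moments, and the limit at [q = 0] *)

Lemma bernoulli_ge0 (R : realType) (n : nat) (y : R) : 0 <= y ->
  1 + n%:R * (y - 1) <= y ^+ n.
Proof.
move=> y0; elim: n => [|n IH]; first by rewrite mul0r addr0.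
rewrite exprS -natr1; have n0 : 0 <= n%:R :> R by [].
have := ler_wpM2l y0 IH; have := mulr_ge0 n0 (sqr_ge0 (y - 1)); nra.
Qed.

(** The base [L] is chosen before [q], so [L ^ q] tends to 1 as [q] tends to 0. Only [C] may depend
    on [q], and it disappears under the [n]-th root. *)
Lemma moment_sinw_ge (R : realType) d : (2 <= d)%N ->
  exists2 L : R, 0 < L & forall q, 0 < q ->
    exists2 C, 0 < C & forall n, C * (L `^ q) ^+ n <= moment (@sinw R) d q n.
Proof.
move=> d2; have d0 : (0 < d)%N by exact: ltn_trans d2.
have dR0 : 0 < d%:R :> R by rewrite ltr0n.
have dn0 : d%:R != 0 :> R by rewrite gt_eqF.
have [e /andP[e0 ed] he] := separated_preimages R d2.
have d10 : 0 < d%:R - 1 :> R by rewrite subr_gt0 ltr1n.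
exists (e `^ (d%:R / (d%:R - 1))).
  by rewrite powR_gt0.
(* [s] is chosen so that [q + s = d s]: with [y := sinw x `^ s] the claim
   [e `^ r * y <= T (sinw `^ s) x] becomes [d y <= (d - 1) + y ^ d]. *)
move=> q q0; pose s := q / (d%:R - 1); pose r := s * d%:R.
have s0 : 0 < s by rewrite divr_gt0.
have r0 : 0 < r by rewrite mulr_gt0.
have qsr : q + s = r by rewrite /r /s; field; rewrite gt_eqF.
have qsE z : z `^ q * z `^ s = z `^ r.
  by rewrite -qsr powRD// qsr gt_eqF.
have ww := weight_sinw R; have [_ w01 _] := ww.
have w0 (t : R) : 0 <= sinw t by case/andP : (w01 t).
exists (\int[lebesgue_measure]_(t in `[0, 1]) (sinw t `^ s : R)).
  exact: Rintegral_sinw_gt0.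
have -> : (e `^ (d%:R / (d%:R - 1))) `^ q = e `^ r.
  by rewrite -powRrM; congr (_ `^ _); rewrite /r /s; ring.
apply: moment_ge_transfer => //.
- exact: continuous_weight_powR.
- by move=> t; apply: powR_unit => //; exact: ltW.
- exact: powR_ge0.
move=> x _; rewrite /transfer/=.
have [k0 hk0] := he sin (@normr_sinB_sin R) x.
under eq_bigr => k _ do rewrite qsE.
pose y := sinw x `^ s; have y0 : 0 <= y by exact: powR_ge0.
have yd : y ^+ d = sinw x `^ r by rewrite -powR_mulrn// /y -powRrM.
rewrite -/y mulrC ler_pdivlMl//.
(* The exceptional preimage [z] satisfies [sinw z >= sinw x / d >= e * sinw x], giving the term in
   [y ^ d]; each of the other [d - 1] satisfies [sinw z >= e]. *)
apply: (@le_trans _ _ (e `^ r * y ^+ d + d.-1%:R * e `^ r)).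
  have dy : d%:R * y <= d.-1%:R + y ^+ d.
    by rewrite -subn1 natrB//; have := bernoulli_ge0 d y0; lra.
  by have := ler_wpM2l (powR_ge0 e r) dy; lra.
apply: (@sum_except_one_ge _ _ _ k0).
  rewrite yd -powRM ?(ltW e0)//; apply: ge0_ler_powR; rewrite ?nnegrE ?(ltW r0)//.
    by rewrite mulr_ge0// ltW.
  apply: (le_trans (ler_wpM2r (w0 x) ed)); rewrite ler_pdivrMl//.
  rewrite -(weightDn k0 x ww) /sinw.
  have -> : pi * (x + k0%:R) = d%:R * (pi * ((x + k0%:R) / d%:R)).
    by rewrite mulrCA (mulrC d%:R) divfK.
  exact: normr_sin_mulnl.
move=> k kk0; apply: ge0_ler_powR; rewrite ?nnegrE ?(ltW r0) ?(ltW e0)//.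
exact: hk0.
Qed.

Lemma powR_cvg_at0 (R : realType) (L : R) : 0 < L ->
  L `^ q @[q --> 0^'+] --> (1 : R).
Proof.
move=> L0; have -> : powR L = fun q => expR (q * ln L).
  by apply/funext => q; rewrite /powR gt_eqF.
apply: cvg_at_right_filter.
have h : expR (q * ln L) @[q --> (0 : R)] --> expR (0 * ln L).
  by apply: continuous_cvg; [exact: continuous_expR|exact: cvgMr_tmp].
by rewrite mul0r expR0 in h.
Qed.

Lemma powR_cvg_pinfty (R : realType) (r : R) : 0 < r < 1 ->
  r `^ q @[q --> +oo] --> (0 : R).
Proof.
move=> /andP[r0 r1]; have -> : powR r = fun q => expR (- (q * - ln r)).
  by apply/funext => q; rewrite /powR gt_eqF// mulrN opprK.
have lnr : 0 < - ln r by rewrite oppr_gt0 ln_lt0// r0.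
apply: (@cvg_comp _ _ _ (fun q : R => q * - ln r) (fun y => expR (- y))
  _ (pinfty_nbhs R)); last exact: cvgr_expR.
by apply: gt0_cvgMly => //; exact: cvg_id.
Qed.

Lemma rate_cvg_at0 (R : realType) (w : R -> R) d (L : R) :
  weight w -> 0 < L ->
  (forall q, 0 < q -> exists2 C, 0 < C &
    forall n, C * (L `^ q) ^+ n <= moment w d q n) ->
  rate w d q @[q --> 0^'+] --> (1 : R).
Proof.
move=> ww L0 hL; apply: (squeeze_cvgr (f := powR L) (h := cst 1)).
- near=> q; have q0 : 0 < q by near: q; exact: nbhs_right_gt.
  have [C C0 hC] := hL q q0; apply/andP; split.
    apply: (@limn_sup_root_ge _ _ C) => //; last exact: powR_gt0.
    by move=> n; exact: moment_unit.
  apply: (@limn_sup_root_le _ _ 1) => // n; first exact: moment_unit.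
  by rewrite expr1n mulr1; case/andP : (moment_unit d n ww q0).
- exact: powR_cvg_at0.
- exact: cvg_cst.
Unshelve. all: end_near. Qed.

Lemma Rintegral01_doubling (R : realType) (f : R -> R) : continuous f ->
  (forall t, f (t + 1) = f t) ->
  \int[lebesgue_measure]_(t in `[0, 1]) f (2 * t) =
  \int[lebesgue_measure]_(t in `[0, 1]) f t.
Proof.
move=> cf f1; rewrite (@Rintegral_01_split _ _ 2)//; last first.
  move=> t; apply: (@continuous_comp _ _ _ ( *%R (2 : R)) f); last exact: cf.
  exact: mulrl_continuous.
rewrite !big_ord_recl big_ord0 addr0/=.
have E k : 2 * ((k : R) / 2) = k by rewrite mulrC divfK.
under eq_Rintegral do rewrite E addr0.
under [X in _ + X]eq_Rintegral do rewrite E f1.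
by lra.
Qed.

(** Factor by factor, [|sin 2y| <= 2 |cos y|] bounds the sine product at [2 t] by [2 ^ n] times the
    cosine product at [t]; doubling the variable preserves the integral of a function of period
    1. *)
Lemma moment_cosw_ge (R : realType) d q n : 0 < q ->
  (2^-1 `^ q) ^+ n * moment (@sinw R) d q n <= moment (@cosw R) d q n.
Proof.
move=> q0; have cs := @continuous_cascade_powR R _ d n q (weight_sinw R) q0.
have w1 (t : R) : cascade (@sinw R) d n (t + 1) `^ q = cascade (@sinw R) d n t `^ q.
  by rewrite (cascadeDn d n 1 t (weight_sinw R)).
have c2 : continuous (fun t : R => cascade (@sinw R) d n (2 * t) `^ q).
  move=> t; apply: (@continuous_comp _ _ _ ( *%R (2 : R))
    (fun t => cascade (@sinw R) d n t `^ q)); last exact: cs.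
  exact: mulrl_continuous.
rewrite /moment -(Rintegral01_doubling cs w1) -RintegralZl//; last first.
  exact: continuous_integrable_itv.
apply: le_Rintegral01.
- exact: continuous_mul_cst.
- exact: continuous_cascade_powR (weight_cosw R) q0.
move=> t _; have cS := cascade_ge0 d n (2 * t) (weight_sinw R).
have cC := cascade_ge0 d n t (weight_cosw R).
rewrite -powR_mulrn ?powR_ge0// powRAC powR_mulrn ?invr_ge0// -powRM ?exprn_ge0 ?invr_ge0//.
apply: ge0_ler_powR; rewrite ?nnegrE ?(ltW q0) ?mulr_ge0 ?exprn_ge0 ?invr_ge0//.
rewrite exprVn ler_pdivrMl ?exprn_gt0//.
rewrite /cascade -[X in 2 ^+ X]subn0 -prodr_const_nat -big_split/=.
apply: ler_prod => j _; rewrite normr_ge0/= /sinw.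
have -> : pi * (d%:R ^+ j * (2 * t)) = (pi * (d%:R ^+ j * t)) *+ 2.
  by rewrite -mulr_natl; ring.
rewrite sin_mulr2n normrMn normrM mulr_natl lerMn2r/= /cosw.
by rewrite ler_piMr// sin_max.
Qed.

(** * The lower bound [1 / d] and the limit at infinity *)

(** Take [h = w ^ q]: the chosen preimage alone contributes [w ^ (2 q) >= w x ^ q] to the sum in
    [transfer], and the other terms are nonnegative. *)
Lemma rate_ge_inv (R : realType) (w : R -> R) d q :
  (0 < d)%N -> weight w -> 0 < q ->
  0 < \int[lebesgue_measure]_(t in `[0, 1]) w t `^ q ->
  (forall x, 0 <= x <= 1 ->
    exists k : 'I_d, w x <= w ((x + k%:R) / d%:R) ^+ 2) ->
  d%:R^-1 <= rate w d q.
Proof.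
move=> d0 ww q0 I0 hw; have [_ w01 _] := ww.
have w0 t : 0 <= w t by case/andP : (w01 t).
have dV0 : 0 < d%:R^-1 :> R by rewrite invr_gt0 ltr0n.
apply: (limn_sup_root_ge _ I0 dV0); first by move=> n; exact: moment_unit.
apply: moment_ge_transfer => //.
- exact: continuous_weight_powR.
- by move=> t; apply: powR_unit => //; exact: ltW.
move=> x /hw[k hk]; rewrite /transfer/= ler_pM2l// (bigD1 k)//= -powRM//.
rewrite -expr2 ler_wpDr//; last first.
  by apply: ge0_ler_powR; rewrite ?nnegrE ?(ltW q0) ?exprn_ge0.
by apply: sumr_ge0 => i _; rewrite mulr_ge0 ?powR_ge0.
Qed.

(** With [y = pi |x| <= pi / 2] and [z = y / d], one has [2 z <= y], hence [cos z ^ 2 = (1 + cos 2z)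
    / 2 >= cos 2z >= cos y]. *)
Lemma cosw_le_sqr (R : realType) (d : nat) (x : R) : (2 <= d)%N ->
  `|x| <= 2^-1 -> cosw x <= cosw (x / d%:R) ^+ 2.
Proof.
move=> d2 x2; have dR0 : 0 < d%:R :> R by rewrite ltr0n (ltn_trans _ d2).
have dge2 : 2 <= d%:R :> R by rewrite ler_nat.
have coswN (z : R) : cosw z = `|cos (pi * `|z|)|.
  by rewrite /cosw -[in RHS](ger0_norm (pi_ge0 R)) -normrM cos_norm.
rewrite (coswN x) (coswN (x / _)) normrM normfV (gtr0_norm dR0).
move: `|x| (normr_ge0 x) x2 => {}x x0 x2.
have pi0 := pi_gt0 R.
have y2 : pi * x <= pi / 2 by rewrite ler_pM2l.
have y0 : 0 <= pi * x by rewrite mulr_ge0// ltW.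
rewrite real_normK ?num_real// mulrA.
rewrite ger0_norm; last by apply: cos_ge0_pihalf; rewrite y2 andbT; lra.
set y := pi * x in y2 y0 *; set z := y / d%:R.
have zy : z *+ 2 <= y.
  by rewrite /z mulr2n -mulrDl ler_pdivrMr//; nra.
have z0 : 0 <= z *+ 2 by rewrite mulrn_wge0// divr_ge0// ltW.
have le1 : cos y <= cos (z *+ 2).
  by rewrite leNgt ltr_cos ?in_itv/= -?leNgt//; apply/andP; split => //; lra.
have := cos_mulr2n z; have := cos_le1 (z *+ 2).
rewrite mulr2n in le1 *; lra.
Qed.

(** The maxima of [cosw] at 0 and 1 are fixed by the branches [k = 0] and [k = d - 1]; the branch
    fixing the one nearer to [x] is used. *)
Lemma cosw_preimage (R : realType) (d : nat) (x : R) : (2 <= d)%N ->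
  0 <= x <= 1 -> exists k : 'I_d, cosw x <= cosw ((x + k%:R) / d%:R) ^+ 2.
Proof.
move=> d2 /andP[x0 x1]; have d0 : (0 < d)%N by exact: ltn_trans d2.
have dn0 : d%:R != 0 :> R by rewrite pnatr_eq0 -lt0n.
have [xh|xh] := leP x 2^-1.
  exists (Ordinal d0); rewrite addr0; apply: cosw_le_sqr => //.
  by rewrite ger0_norm.
have dd : (d.-1 < d)%N by rewrite prednK.
have [_ _ w1] := weight_cosw R.
exists (Ordinal dd) => /=.
have -> : (x + d.-1%:R) / d%:R = (x - 1) / d%:R + 1.
  by rewrite -subn1 natrB//; field.
rewrite w1 -{1}(subrK 1 x) w1; apply: cosw_le_sqr => //.
rewrite ler0_norm ?subr_le0//; lra.
Qed.

Lemma sinwE (R : realType) (t : R) : sinw t = cosw (t - 2^-1).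
Proof. by rewrite /sinw /cosw mulrBr cosBpihalf. Qed.

(** For odd [d] the middle branch [k = (d - 1) / 2] fixes the maximum 1/2 of [sinw]; centred there,
    it is division by [d]. *)
Lemma sinw_preimage (R : realType) (d : nat) (x : R) : (2 <= d)%N -> odd d ->
  0 <= x <= 1 -> exists k : 'I_d, sinw x <= sinw ((x + k%:R) / d%:R) ^+ 2.
Proof.
move=> d2 od /andP[x0 x1]; have d0 : (0 < d)%N by exact: ltn_trans d2.
have dn0 : d%:R != 0 :> R by rewrite pnatr_eq0 -lt0n.
have dE : d%:R = 1 + 2 * d./2%:R :> R.
  by rewrite -{1}(odd_double_half d) od natrD -muln2 natrM mulrC.
have dd : (d./2 < d)%N by rewrite ltn_half_double -addnn -{1}(addn0 d) ltn_add2l.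
exists (Ordinal dd) => /=; rewrite !sinwE.
have -> : (x + d./2%:R) / d%:R - 2^-1 = (x - 2^-1) / d%:R.
  have -> : d./2%:R = (d%:R - 1) / 2 :> R by rewrite dE; field.
  by field.
apply: cosw_le_sqr => //; rewrite ler_norml; lra.
Qed.

Lemma rate_cvg_pinfty (R : realType) (w u : R -> R) d :
  (2 <= d)%N -> weight w ->
  (forall x y, `|sin (x - y)| <= `|u x| + `|u y|) ->
  (forall t, w t ^+ 2 + u (pi * t) ^+ 2 = 1) ->
  (forall q, 0 < q -> d%:R^-1 <= rate w d q) ->
  rate w d q @[q --> +oo] --> (d%:R^-1 : R).
Proof.
move=> d2 ww hu wu hq; have [r r01 hr] := rate_le_separated d2 ww hu wu.
apply: (squeeze_cvgr (f := cst d%:R^-1)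
    (h := fun q => d%:R^-1 * (1 + d.-1%:R * r `^ q))).
- near=> q; have q0 : 0 < q by near: q; exact: nbhs_pinfty_gt.
  by rewrite hq// hr.
- exact: cvg_cst.
have h : d%:R^-1 * (1 + d.-1%:R * r `^ q) @[q --> +oo] -->
    (d%:R^-1 * (1 + d.-1%:R * 0) : R).
  apply: cvgMl_tmp; apply: cvgD; first exact: cvg_cst.
  by apply: cvgMl_tmp; exact: powR_cvg_pinfty.
by rewrite mulr0 addr0 mulr1 in h.
Unshelve. all: end_near. Qed.

(** * Decay of the sine product for even [d] *)

(** Since [d y = (d / 2) (2 y)] with [d / 2] an integer, [|sin (d y)| <= (d / 2) |sin 2y| <= d |cos
    y|]. *)
Lemma sinw_mul_even (R : realType) d (t : R) : (0 < d)%N -> ~~ odd d ->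
  sinw t ^+ 2 + (sinw (d%:R * t) / d%:R) ^+ 2 <= 1.
Proof.
move=> d0 ed; have dR0 : 0 < d%:R :> R by rewrite ltr0n.
have dE : d%:R = 2 * d./2%:R :> R.
  by rewrite -{1}(odd_double_half d) (negbTE ed) add0n -muln2 natrM mulrC.
have H : sinw (d%:R * t) / d%:R <= `|cos (pi * t)|.
  rewrite ler_pdivrMr// [leRHS]mulrC /sinw dE.
  have -> : pi * (2 * d./2%:R * t) = d./2%:R * ((pi * t) *+ 2).
    by rewrite -mulr_natl; ring.
  rewrite (le_trans (normr_sin_mulnl _ _))// sin_mulr2n normrMn normrM.
  have m0 : 0 <= d./2%:R :> R by [].
  have cs : `|cos (pi * t)| * `|sin (pi * t)| <= `|cos (pi * t)|.
    by rewrite ler_piMr// sin_max.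
  by have := ler_wpM2l m0 cs; rewrite mulr2n; lra.
have s0 : 0 <= sinw (d%:R * t) / d%:R by rewrite divr_ge0 ?normr_ge0.
have -> : sinw t ^+ 2 = 1 - `|cos (pi * t)| ^+ 2.
  by rewrite /sinw !real_normK ?num_real// sin2cos2.
have : (sinw (d%:R * t) / d%:R) ^+ 2 <= `|cos (pi * t)| ^+ 2.
  by rewrite ler_sqr ?nnegrE.
by lra.
Qed.

(** The square of the product regroups into [n] products of consecutive factors, each at most
    [1 - d ^ -2 / 2], times the first and the last factor. The first is bounded by 1; the last is
    kept to form the next pair in the induction. *)
Lemma cascade_sinw_even (R : realType) d n (t : R) : (2 <= d)%N -> ~~ odd d ->
  cascade (@sinw R) d n.+1 t ^+ 2 <=
  (1 - d%:R ^- 2 / 2) ^+ n * sinw (d%:R ^+ n * t).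
Proof.
move=> d2 ed; have d0 : (0 < d)%N by exact: ltn_trans d2.
have dge2 : 2 <= d%:R :> R by rewrite ler_nat.
have d20 : 0 < d%:R ^- 2 :> R by rewrite invr_gt0 exprn_gt0// ltr0n.
have d21 : d%:R ^- 2 <= 4^-1 :> R.
  by rewrite lef_pV2 ?posrE ?exprn_gt0 ?ltr0n//; nra.
have s01 (z : R) : 0 <= sinw z <= 1 by have [_ s01 _] := weight_sinw R; exact: s01.
(* With [e = d ^ -2] and [B = sinw (d z) ^ 2], the squared left side is at most [(1 - e B) B = 1 - e
   - (1 - B) (1 - e (1 + B))], hence at most [1 - e <= (1 - e / 2) ^ 2]. *)
have step (z : R) : sinw z * sinw (d%:R * z) <= 1 - d%:R ^- 2 / 2.
  have := sinw_mul_even z d0 ed; rewrite exprMn exprVn.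
  have := s01 z; have := s01 (d%:R * z).
  move: (sinw z) (sinw _) (d%:R ^- 2) d20 d21 => a b e e0 e1 /andP[b0 b1] /andP[a0 a1] ab.
  rewrite -ler_sqr ?nnegrE ?mulr_ge0//; last lra.
  have b20 := sqr_ge0 b; have b21 : b ^+ 2 <= 1 by nra.
  rewrite exprMn; move: (b ^+ 2) b20 b21 ab => B B0 B1 aB.
  have aBB := ler_wpM2r B0 aB.
  have : 0 <= (1 - B) * (1 - e * (1 + B)) by apply: mulr_ge0; nra.
  by have := sqr_ge0 (e / 2); nra.
elim: n => [|n IH].
  rewrite /cascade big_nat1 !expr0 !mul1r; have /andP[z0 z1] := s01 t.
  by rewrite expr2 ler_piMl.
rewrite /cascade big_nat_recr//= exprMn -/(cascade _ _ _ _).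
have /andP[a0 a1] := s01 (d%:R ^+ n * t).
have /andP[b0 b1] := s01 (d%:R ^+ n.+1 * t).
apply: (le_trans (ler_wpM2r (sqr_ge0 _) IH)).
have := step (d%:R ^+ n * t); rewrite mulrA -exprS => st.
move: (sinw _) (sinw _) a0 a1 b0 b1 st => b a a0 a1 b0 b1 st.
rewrite [_ ^+ n.+1]exprSr -!mulrA ler_wpM2l//; first by rewrite exprn_ge0//; lra.
by rewrite expr2 mulrA ler_wpM2r.
Qed.

Lemma rate_sinw_even (R : realType) d (q : R) : (2 <= d)%N -> ~~ odd d ->
  0 < q -> rate (@sinw R) d q <= (1 - d%:R ^- 2 / 2) `^ (q / 2).
Proof.
move=> d2 ed q0; have d0 : (0 < d)%N by exact: ltn_trans d2.
have dge2 : 2 <= d%:R :> R by rewrite ler_nat.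
have d21 : d%:R ^- 2 <= 1 :> R.
  by rewrite invf_le1// ?exprn_gt0 ?ltr0n//; nra.
set kap := 1 - _; have kap0 : 0 < kap by rewrite /kap; lra.
have kq0 : 0 < kap `^ (q / 2) by rewrite powR_gt0.
have ws := weight_sinw R.
have k1 : kap `^ (q / 2) <= 1.
  have /powR_unit : 0 <= kap <= 1.
    rewrite ltW//= /kap gerBl divr_ge0// invr_ge0 exprn_ge0//.
  by move=> /(_ _ (divr_ge0 (ltW q0) (ler0n _ 2)))/andP[].
(* There are only [n] consecutive pairs among [n + 1] factors; this constant makes up for the
   missing power. *)
apply: (@limn_sup_root_le _ _ (kap `^ (q / 2))^-1) => //.
- by move=> n; exact: moment_unit.
- by rewrite invr_gt0.
case=> [|n].
  rewrite mulr1; have /andP[_] := moment_unit d 0 ws q0.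
  by move=> /le_trans; apply; rewrite invf_ge1.
rewrite exprS mulKf ?gt_eqF// -[leRHS]Rintegral01_cst.
apply: le_Rintegral01.
- exact: continuous_cascade_powR.
- by move=> x; exact: cvg_cst.
move=> t _; have c0 := cascade_ge0 d n.+1 t ws.
have -> : cascade (@sinw R) d n.+1 t `^ q = (cascade (@sinw R) d n.+1 t ^+ 2) `^ (q / 2).
  by rewrite -powR_mulrn// -powRrM mulrC divfK.
have powX (x r : R) : 0 <= x -> (x `^ r) ^+ n = (x ^+ n) `^ r.
  move=> x0; rewrite -(powR_mulrn n (powR_ge0 x r)) -(powR_mulrn n x0).
  exact: powRAC.
rewrite powX ?(ltW kap0)//.
apply: ge0_ler_powR; rewrite ?nnegrE ?exprn_ge0 ?divr_ge0 ?(ltW kap0) ?(ltW q0)//.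
apply: (le_trans (cascade_sinw_even n t d2 ed)).
rewrite ler_piMr ?exprn_ge0 ?(ltW kap0)//.
by have [_ s01 _] := ws; case/andP : (s01 (d%:R ^+ n * t)).
Qed.

Lemma rate_sinw_even_cvg (R : realType) d : (2 <= d)%N -> ~~ odd d ->
  rate (@sinw R) d q @[q --> +oo] --> (0 : R).
Proof.
move=> d2 ed; have dge2 : 2 <= d%:R :> R by rewrite ler_nat.
have d20 : 0 < d%:R ^- 2 :> R by rewrite invr_gt0 exprn_gt0// ltr0n (ltn_trans _ d2).
have d21 : d%:R ^- 2 <= 1 :> R.
  by rewrite invf_le1// ?exprn_gt0 ?ltr0n// ?(ltn_trans _ d2)//; nra.
pose kap : R := 1 - d%:R ^- 2 / 2.
have kap01 : 0 < kap < 1 by rewrite /kap; apply/andP; split; lra.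
have r01 : 0 < kap `^ 2^-1 < 1.
  case/andP: kap01 => k0 k1; rewrite powR_gt0//=.
  have h2 : 0 < 2^-1 :> R by rewrite invr_gt0.
  have := @gt0_ltr_powR _ _ h2 kap 1; rewrite !nnegrE powR1; apply => //.
  exact: ltW.
apply: (squeeze_cvgr (f := cst 0) (h := powR (kap `^ 2^-1))).
- near=> q; have q0 : 0 < q by near: q; exact: nbhs_pinfty_gt.
  rewrite -powRrM mulrC rate_sinw_even// andbT.
  apply: (@le_trans _ _ (limn_sup (fun=> 0 : R^o))).
    by have [_ ->] := cvg_limn_inf_sup (@cvg_cst R^o 0 _ \oo _).
  apply: le_limn_sup.
  + by apply: unit_bounded_fun => n; rewrite lexx ler01.
  + apply: unit_bounded_fun => n; apply: powR_unit => //.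
    exact/moment_unit/q0/weight_sinw.
  + by move=> n; exact: powR_ge0.
- exact: cvg_cst.
- exact: powR_cvg_pinfty.
Unshelve. all: end_near. Qed.

(** * Convexity, monotonicity and limits of both rates *)

Theorem theorem3p1 (R : realType) (d : nat) (hd : (2 <= d)%N) :
  [/\ convex_function (`]0, +oo[%classic : set R^o) (cos_rate d : R^o -> R^o),
      convex_function (`]0, +oo[%classic : set R^o) (sin_rate d : R^o -> R^o),
      {in `]0, +oo[ &, nonincreasing_fun (cos_rate d : R -> R)} &
      {in `]0, +oo[ &, nonincreasing_fun (sin_rate d : R -> R)}] /\
  [/\ cos_rate d q @[q --> +oo] --> (d%:R^-1 : R),
      sin_rate d q @[q --> +oo] --> (if odd d then d%:R^-1 else 0 : R),
      cos_rate d q @[q --> 0^'+] --> (1 : R) &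
      sin_rate d q @[q --> 0^'+] --> (1 : R)].
Proof.
have d0 : (0 < d)%N by exact: ltn_trans hd.
rewrite cos_rateE sin_rateE; have wc := weight_cosw R; have ws := weight_sinw R.
have [L L0 hL] := moment_sinw_ge R hd.
(* The comparison of cosine with sine costs [2 ^ -q] per factor, so [L] becomes [L / 2], still
   independent of [q]. *)
have hL' q : 0 < q -> exists2 C, 0 < C &
    forall n, C * ((2^-1 * L) `^ q) ^+ n <= moment (@cosw R) d q n.
  move=> q0; have [C C0 hC] := hL q q0; exists C; [exact: C0|move=> n].
  apply: le_trans (moment_cosw_ge d n q0).
  rewrite powRM ?invr_ge0 ?(ltW L0)// exprMn mulrCA.
  by apply: ler_wpM2l; [rewrite exprn_ge0 ?powR_ge0|exact: hC].
have L'0 : 0 < 2^-1 * L by rewrite mulr_gt0 ?invr_gt0.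
(* The geometric lower bounds also give the positivity of the moments that convexity requires. *)
have ms q n : 0 < q -> 0 < moment (@sinw R) d q n.
  move=> q0; have [C C0 /(_ n)] := hL q q0; apply: lt_le_trans.
  by rewrite mulr_gt0 ?exprn_gt0 ?powR_gt0.
have mc q n : 0 < q -> 0 < moment (@cosw R) d q n.
  move=> q0; have [C C0 /(_ n)] := hL' q q0; apply: lt_le_trans.
  by rewrite mulr_gt0 ?exprn_gt0 ?powR_gt0.
split; split.
- exact: convex_rate.
- exact: convex_rate.
- move=> p q; rewrite !in_itv/= !andbT => p0 q0; exact: nonincreasing_rate.
- move=> p q; rewrite !in_itv/= !andbT => p0 q0; exact: nonincreasing_rate.
- apply: (rate_cvg_pinfty (u := sin)) => //.
  + exact: normr_sinB_sin.
  + by move=> t; rewrite /cosw real_normK ?num_real// cos2Dsin2.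
  + move=> q q0; apply: rate_ge_inv => //; first exact: Rintegral_cosw_gt0.
    by move=> x; exact: cosw_preimage.
- have [od|ed] := boolP (odd d); last exact: rate_sinw_even_cvg.
  apply: (rate_cvg_pinfty (u := cos)) => //.
  + exact: normr_sinB_cos.
  + by move=> t; rewrite /sinw real_normK ?num_real// addrC cos2Dsin2.
  + move=> q q0; apply: rate_ge_inv => //; first exact: Rintegral_sinw_gt0.
    by move=> x; exact: sinw_preimage.
- exact: (rate_cvg_at0 wc L'0).
- exact: (rate_cvg_at0 ws L0).
Qed.
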